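(* Suppose that the joint probability distribution of the intermittent supply process $\mathbf{s}$ is absolutely continuous and has compact support. Define the pricing scheme $\boldsymbol{\zeta}=(\zeta_1,\dots,\zeta_N)$ on $\mathbb{R}_+^N$ by $$\frac{\zeta_k(\mathbf{x})}{c_0}=\mathbb{P}(\xi_k\le 0)+\sum_{t=k+1}^N\mathbb{P}(\xi_k>0,\ldots,\xi_{t-1}>0,\ \xi_t\le 0),\qquad k=1,\dots,N,$$ where $\xi_k=\xi_k(\mathbf{x},\mathbf{s})$ is the residual process. Then $\boldsymbol{\zeta}$ maps $\mathbb{R}_+^N$ into $\mathcal{P}$, and an allocation $\mathbf{x}\in\mathbb{R}_+^N$ is profit maximizing for a given price bundle $\mathbf{p}\in\mathcal{P}$ if $\mathbf{p}=\boldsymbol{\zeta}(\mathbf{x})$.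
   Context: Fix $N\ge1$ and a price $c_0>0$ of firm supply. The intermittent supply is a random process $\mathbf{s}=(s_0,\dots,s_{N-1})$, each $s_k$ taking values in an interval $\mathcal{S}\subset\mathbb{R}_+$. The set of price bundles is $\mathcal{P}=\{\mathbf{p}\in\mathbb{R}_+^N : p_1\ge p_2\ge\cdots\ge p_N\}$. Scheduling: given $\mathbf{x}\in\mathbb{R}_+^N$, let $\mathbf{z}_0=\mathbf{x}$, $\mathbf{z}_{k+1}=\mathbf{z}_k-\mathbf{u}_k-\mathbf{v}_k$ for $k=0,\dots,N-1$, where $\mathbf{u}_k,\mathbf{v}_k\in\mathbb{R}_+^N$ are intermittent and firm supply allocated to the demand classes in period $k$. Let $\mathcal{Z}_k=\{\mathbf{z}\in\mathbb{R}_+^N: z^j=0\ \forall j\le k\}$ and $\mathcal{U}_k(\mathbf{z},s)=\{(\mathbf{u},\mathbf{v})\in\mathbb{R}_+^N\times\mathbb{R}_+^N:\mathbf{1}^\top\mathbf{u}\le s,\ \mathbf{z}-\mathbf{u}-\mathbf{v}\in\mathcal{Z}_{k+1}\}$. A feasible inter-class scheduling policy $\sigma\in\Sigma(\mathbf{x})$ is a sequence of (measurable) functions $\boldsymbol{\mu}_k,\boldsymbol{\nu}_k:\mathcal{Z}_k\times\mathcal{S}\to\mathbb{R}_+^N$, $k=0,\dots,N-1$, with $(\boldsymbol{\mu}_k(\mathbf{z},s),\boldsymbol{\nu}_k(\mathbf{z},s))\in\mathcal{U}_k(\mathbf{z},s)$ for all $(\mathbf{z},s)$; then $\mathbf{u}_k=\boldsymbol{\mu}_k(\mathbf{z}_k,s_k)$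 and $\mathbf{v}_k=\mathbf{v}_k^\sigma=\boldsymbol{\nu}_k(\mathbf{z}_k,s_k)$. The EDF policy $\sigma^*$ is $\mu_k^{j,*}(\mathbf{z},s)=\min\{z^j,\ s-\sum_{i=1}^{j-1}\mu_k^{i,*}(\mathbf{z},s)\}$ and $\nu_k^{j,*}(\mathbf{z},s)=(z^j-\mu_k^{j,*}(\mathbf{z},s))\mathbf{1}_{\{k=j-1\}}$. Expected cost and profit: $Q(\mathbf{x},\sigma)=\sum_{k=0}^{N-1}\mathbb{E}\{\mathbf{c}^\top\mathbf{v}_k^\sigma\}$ with $\mathbf{c}=(c_0,\dots,c_0)$, and $J(\mathbf{x},\mathbf{p},\sigma)=\mathbf{p}^\top\mathbf{x}-Q(\mathbf{x},\sigma)$. The EDF policy is the supplier's optimal (cost-minimizing) policy for every $\mathbf{x}$; an allocation $\mathbf{x}\in\mathbb{R}_+^N$ is profit maximizing for $\mathbf{p}$ if $J(\mathbf{x},\mathbf{p},\sigma^* )\ge J(\mathbf{y},\mathbf{p},\sigma^* )$ for all $\mathbf{y}\in\mathbb{R}_+^N$. Residual process: $\xi_0=0$ and $\xi_{k+1}(\mathbf{x},\mathbf{s})=\max\{0,\xi_k(\mathbf{x},\mathbf{s})\}+s_k-x_{k+1}$ for $k=0,\dots,N-1$. *)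

(* Defs.v *)
From HB Require Import structures.
From mathcomp Require Import all_boot all_order all_algebra.
From mathcomp Require Import all_classical all_reals all_analysis.

Set Implicit Arguments.
Unset Strict Implicit.
Unset Printing Implicit Defensive.

Import Order.TTheory GRing.Theory Num.Theory.
Import numFieldNormedType.Exports.

Local Open Scope classical_set_scope.
Local Open Scope ring_scope.

(* Vectors of R^N are [N.-tuple R] (the type carrying the product
   sigma-algebra).  Tuples are indexed from 0: the 1-based component a_{j+1} of
   an allocation or a price bundle is [a`_j], whereas the 0-based supply s_k is
   [s`_k]. *)

Section lebesgue_tuple.
Context {R : realType}.

Section cons_measure.
Variables (n : nat) (mu : {sigma_finite_measure set (n.-tuple R) -> \bar R}).

Definition tuple_of_pair (u : measurableTypeR R * n.-tuple R) : n.+1.-tuple R :=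
  [tuple of u.1 :: u.2].

Lemma measurable_tuple_of_pair : measurable_fun [set: _] tuple_of_pair.
Proof.
exact: (@measurable_cons _ _ (measurableTypeR R * n.-tuple R)%type R fst n snd).
Qed.

Definition cons_measure : set (n.+1.-tuple R) -> \bar R :=
  pushforward (@lebesgue_measure R \x mu)%E tuple_of_pair.

Let cons0 : cons_measure set0 = 0%E.
Proof. by rewrite /cons_measure /pushforward preimage_set0 measure0. Qed.

Let cons_ge0 A : (0 <= cons_measure A)%E.
Proof. by rewrite /cons_measure /pushforward; exact: integral_ge0. Qed.

Let cons_sigma_additive : semi_sigma_additive cons_measure.
Proof.
move=> F mF tF mUF; rewrite /cons_measure /pushforward preimage_bigcup.
have mp A : measurable A -> measurable (tuple_of_pair @^-1` A).
  by move=> mA; rewrite -[X in measurable X]setTI; exact: measurable_tuple_of_pair.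
apply: measure_semi_sigma_additive.
- by move=> k; exact: mp.
- apply/trivIsetP => /= i j _ _ ij; rewrite -preimage_setI.
  by move/trivIsetP : tF => /(_ _ _ _ _ ij) ->//; rewrite preimage_set0.
- by rewrite -preimage_bigcup; exact: mp.
Qed.

HB.instance Definition _ := isMeasure.Build _ _ _ cons_measure
  cons0 cons_ge0 cons_sigma_additive.

Let cons_sigma_finite : sigma_finite setT cons_measure.
Proof.
have /sigma_finiteP[F [TF ndF Foo]] := sigma_finiteT (@lebesgue_measure R).
have /sigma_finiteP[G [TG ndG Goo]] := sigma_finiteT mu.
pose g (t : n.+1.-tuple R) : measurableTypeR R * n.-tuple R :=
  (thead t, [tuple of behead t]).
have mg : measurable_fun setT g.
  apply/measurable_fun_pairP; split; first exact: measurable_tnth.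
  exact: measurable_behead.
have gK u : g (tuple_of_pair u) = u.
  by case: u => a t; congr pair; apply: val_inj.
exists (fun k => g @^-1` (F k `*` G k)).
  rewrite -preimage_bigcup -(@preimage_setT _ _ g); congr (_ @^-1` _).
  rewrite -setXTT TF TG predeqE => -[x y]; split.
    move=> [/= [k _ Fkx] [l _ Gly]]; exists (maxn k l) => //; split.
    - by move: x Fkx; exact/subsetPset/ndF/leq_maxl.
    - by move: y Gly; exact/subsetPset/ndG/leq_maxr.
  by move=> [k _ []/= ? ?]; split; exists k.
move=> k; have [mFk Fk] := Foo k; have [mGk Gk] := Goo k; split.
  by rewrite -[X in measurable X]setTI; apply: mg => //; exact: measurableX.
rewrite /cons_measure /pushforward -comp_preimage.
rewrite (_ : g \o _ = id); last by apply/funext => u /=; rewrite gK.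
by rewrite preimage_id product_measure1E// lte_mul_pinfty// ge0_fin_numE.
Qed.

HB.instance Definition _ := Measure_isSigmaFinite.Build _ _ _ cons_measure
  cons_sigma_finite.

End cons_measure.

Let dirac_nil_sigma_finite :
  sigma_finite setT (\d_([tuple] : 0.-tuple R) : set _ -> \bar R).
Proof. by apply: fin_num_fun_sigma_finite; [rewrite measure0|exact: fin_num_measure]. Qed.

(* Lebesgue measure on R^n, as an iterated product measure. *)
Fixpoint lebesgue_tuple (n : nat) :
    {sigma_finite_measure set (n.-tuple R) -> \bar R} :=
  match n with
  | 0 => \d_([tuple] : 0.-tuple R)
  | m.+1 => cons_measure (lebesgue_tuple m)
  end.

Lemma lebesgue_tuple_box n (a b : n.-tuple R) :
  (forall i, tnth a i <= tnth b i) ->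
  lebesgue_tuple n [set t | forall i, tnth t i \in `]tnth a i, tnth b i] ] =
  (\prod_(i < n) (tnth b i - tnth a i))%:E.
Proof.
elim: n a b => [|n IH] a b ab.
  rewrite big_ord0 /= diracE mem_set// => -[].
  by [].
pose a' := [tuple of behead a]; pose b' := [tuple of behead b].
have aS i : tnth a (lift ord0 i) = tnth a' i by rewrite [in LHS](tuple_eta a) tnthS.
have bS i : tnth b (lift ord0 i) = tnth b' i by rewrite [in LHS](tuple_eta b) tnthS.
rewrite big_ord_recl /= /cons_measure /pushforward.
pose B' := [set t : n.-tuple R | forall i, tnth t i \in `]tnth a' i, tnth b' i]].
have -> : (tuple_of_pair (n := n)) @^-1`
    [set t | forall i, tnth t i \in `]tnth a i, tnth b i] ] =
    `]tnth a ord0, tnth b ord0] `*` B'.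
  apply/seteqP; split => -[x t] /=.
    move=> h; split; first by have := h ord0.
    by move=> i; have := h (lift ord0 i); rewrite tnthS aS bS.
  move=> [h0 h] i; case: (unliftP ord0 i) => [j|] ->.
    by rewrite tnthS aS bS; exact: h.
  exact: h0.
rewrite product_measure1E//; last first.
  rewrite (_ : B' = \bigcap_(i in [set: 'I_n])
     ((fun t : n.-tuple R => tnth t i) @^-1` `]tnth a' i, tnth b' i])).
    apply: fin_bigcap_measurable => [|i _]; first exact: finite_finset.
    by rewrite -[X in measurable X]setTI; exact: measurable_tnth.
  by apply/seteqP; split=> [t /= h i _|t /= h i]; [exact: h|exact: (h i I)].
rewrite EFinM; congr (_ * _)%E; last first.
  rewrite IH; last by move=> i; rewrite -aS -bS.
  by congr EFin; apply: eq_bigr => i _; rewrite aS bS.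
apply: etrans (lebesgue_measure_itv `]tnth a ord0, tnth b ord0]) _.
rewrite /= lte_fin; case: ltP => [_|h]; first by rewrite EFinB.
apply/eqP; by rewrite eqe eq_sym subr_eq0 eq_le h; exact: ab.
Qed.

End lebesgue_tuple.

(* Topological support of a measure on R^N; points are row vectors only because
   the topology of R^N lives there. *)
Definition measure_support (R : realType) (N : nat)
    (mu : set (N.-tuple R) -> \bar R) : set 'rV[R]_N :=
  [set a | forall U : set 'rV[R]_N, open U -> U a ->
     (0 < mu [set t | U (\row_i tnth t i)])%E].

Section market.
Context {R : realType} {N : nat}.
Implicit Types (x y p z : N.-tuple R).

Definition nonneg_orthant : set (N.-tuple R) :=
  [set x | forall j, 0 <= tnth x j].

Definition price_bundles : set (N.-tuple R) :=
  [set p | nonneg_orthant p /\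
           forall i j : 'I_N, (i <= j)%N -> tnth p j <= tnth p i].

(* The functions mu_k and nu_k of a scheduling policy: the supply allocated in
   period k when the residual demand is z and the intermittent supply is s. *)
Record policy := Policy {
  intermittent : nat -> N.-tuple R -> R -> N.-tuple R;
  firm : nat -> N.-tuple R -> R -> N.-tuple R }.

(* [edf_used z s j] is the intermittent supply granted to the j first classes;
   see [edf_muE] for the usual recursion. *)
Fixpoint edf_used (z : seq R) (s : R) (j : nat) : R :=
  if j is i.+1 then edf_used z s i + Num.min z`_i (s - edf_used z s i) else 0.

Definition edf_mu z (s : R) : N.-tuple R :=
  [tuple Num.min (tnth z j) (s - edf_used z s j) | j < N].

Lemma edf_muE z s (j : 'I_N) :
  tnth (edf_mu z s) j =
  Num.min (tnth z j) (s - \sum_(i < N | (i < j)%N) tnth (edf_mu z s) i).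
Proof.
rewrite [in LHS]/edf_mu tnth_mktuple; congr (Num.min _ (_ - _)).
have: (j <= N)%N by exact: ltnW.
elim: (j : nat) => [_|k IH kN]; first by rewrite big_pred0.
rewrite /= (IH (ltnW kN)) [RHS](bigD1 (Ordinal kN))//= addrC; congr (_ + _).
  by apply: eq_bigl => i; rewrite ltnS -val_eqE /= [RHS]andbC ltn_neqAle.
by rewrite -(IH (ltnW kN)) tnth_mktuple (tnth_nth 0).
Qed.

Definition edf : policy := {|
  intermittent := fun _ z s => edf_mu z s;
  firm := fun k z s =>
    [tuple (tnth z j - tnth (edf_mu z s) j) * (k == j)%:R | j < N] |}.

Fixpoint demand (sigma : policy) x (s : N.-tuple R) (k : nat) : N.-tuple R :=
  if k is i.+1 then
    let z := demand sigma x s i in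
    [tuple tnth z j - tnth (intermittent sigma i z s`_i) j
         - tnth (firm sigma i z s`_i) j | j < N]
  else x.

Definition firm_used (sigma : policy) x (s : N.-tuple R) (k : nat) : N.-tuple R :=
  firm sigma k (demand sigma x s k) s`_k.

Fixpoint residual x (s : N.-tuple R) (k : nat) : R :=
  if k is i.+1 then Num.max 0 (residual x s i) + s`_i - x`_i else 0.

Section random_supply.
Context {d : measure_display} {T : measurableType d}.
Variables (P : probability T R) (c0 : R) (s : T -> N.-tuple R).

Definition expected_cost x (sigma : policy) : \bar R :=
  (\sum_(k < N)
     'E_P[fun w => (\sum_(j < N) c0 * tnth (firm_used sigma x (s w) k) j)%R])%E.

Definition expected_profit x p (sigma : policy) : \bar R :=
  ((\sum_(j < N) tnth p j * tnth x j)%:E - expected_cost x sigma)%E.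

Definition profit_maximizing p x : Prop :=
  forall y, nonneg_orthant y ->
    (expected_profit y p edf <= expected_profit x p edf)%E.

(* Component j is zeta_k with k = j + 1. *)
Definition zeta x : N.-tuple R :=
  [tuple let k := j.+1 in
    c0 * (fine (P [set w | residual x (s w) k <= 0]) +
          \sum_(k.+1 <= t < N.+1)
            fine (P [set w | (forall i, (k <= i < t)%N -> 0 < residual x (s w) i)
                             /\ residual x (s w) t <= 0]))
  | j < N].

End random_supply.
End market.

(* Main.v *)
(** The firm supply bought by EDF in period k is the negative part of xi_{k+1}.
    Summing over the first m periods gives max 0 xi_m plus the sum of the
    x_{k+1} - s_k, and max 0 xi_m is a maximum of affine functions of x, so for
    every supply path the cost is convex in x.  The indicator of the event
    "xi_t <= 0 for some t with k <= t <= N" is the k-th component of a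
    subgradient of cost/c0 at x, and its expectation is zeta_k(x)/c0: the event
    is split according to the first such t.  Hence p = zeta(x) is a subgradient
    at x of the convex expected cost, so that x maximizes p.y minus the expected
    cost of y. *)

Require Import Defs.
From HB Require Import structures.
From mathcomp Require Import all_boot all_order all_algebra.
From mathcomp Require Import all_classical all_reals all_analysis.
From mathcomp Require Import measurable_realfun ring lra.
Import Order.TTheory GRing.Theory Num.Theory.
Import numFieldNormedType.Exports.
Local Open Scope classical_set_scope.
Local Open Scope ring_scope.

(** * EDF scheduling along a fixed supply path *)

Section pathwise.
Context {R : realType} {N : nat}.
Implicit Types (x y s z : N.-tuple R).

Ltac minmax_lra :=
  repeat match goal with
  | |- context [Num.min ?a ?b] => case: (lerP a b)
  | |- context [Num.max ?a ?b] => case: (lerP a b)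
  end; move=> *; lra.

Lemma max0B_min (a y : R) : 0 <= a ->
  Num.max 0 y - Num.min a (Num.max 0 y) = Num.max 0 (y - a).
Proof. by move=> a0; minmax_lra. Qed.

(** Greedy filling meets every demand until [s] runs out; from then on [z]_i >=
    0[makes each grant]min z[_i 0 = 0]. *)
Lemma edf_usedE (z : seq R) (s : R) (j : nat) :
  (forall i, 0 <= z`_i) -> 0 <= s ->
  edf_used z s j = Num.min s (\sum_(0 <= i < j) z`_i).
Proof.
move=> z0 s0; elim: j => [|j IH] /=; first by rewrite big_geq// min_r.
rewrite IH big_nat_recr//=; have := z0 j; set C := \sum_(0 <= i < j) _ => zj.
minmax_lra.
Qed.

Lemma nonneg_nth z : nonneg_orthant z -> forall i, 0 <= z`_i.
Proof.
move=> z0 i; have [iN|Ni] := ltnP i N; last by rewrite nth_default ?size_tuple.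
by have := z0 (Ordinal iN); rewrite (tnth_nth 0).
Qed.

Lemma edf_muB z (s : R) (j : 'I_N) :
  tnth (edf_mu z s) j = edf_used z s j.+1 - edf_used z s j.
Proof. by rewrite tnth_mktuple (tnth_nth 0)/=; lra. Qed.

Lemma nth_demandS x s k i : (k < N)%N -> (i < N)%N ->
  (demand edf x s k.+1)`_i =
  (demand edf x s k)`_i
  - (edf_used (demand edf x s k) s`_k i.+1 - edf_used (demand edf x s k) s`_k i)
  - ((demand edf x s k)`_i
     - (edf_used (demand edf x s k) s`_k i.+1
        - edf_used (demand edf x s k) s`_k i)) * (k == i)%:R.
Proof.
move=> kN iN; rewrite -(tnth_nth 0 (demand edf x s k.+1) (Ordinal iN)).
rewrite [demand _ _ _ k.+1]/= tnth_mktuple.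
by rewrite [X in _ - X = _]tnth_mktuple edf_muB !(tnth_nth 0).
Qed.

Lemma sum_delta (D : nat -> R) k j :
  \sum_(0 <= i < j) D i * (k == i)%:R = if (k < j)%N then D k else 0.
Proof.
elim: j => [|j IH]; first by rewrite big_geq.
rewrite big_nat_recr//= IH ltnS; case: (ltngtP k j) => [kj|kj|->].
- by rewrite mulr0 addr0.
- by rewrite mulr0 addr0.
- by rewrite mulr1 add0r.
Qed.

Lemma cumul_nonneg x z (k : nat) (h : R) : nonneg_orthant x -> 0 <= h ->
  (forall j, (j <= N)%N -> \sum_(0 <= i < j) z`_i =
     Num.max 0 (\sum_(k <= i < j) x`_i - h)) ->
  forall i, 0 <= z`_i.
Proof.
move=> x0 h0 cum i.
have [iN|Ni] := ltnP i N; last by rewrite nth_default ?size_tuple.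
have := cum i.+1 iN; rewrite big_nat_recr//= cum ?(ltnW iN)//.
have [ki|ik] := leqP k i; last first.
  by rewrite !big_geq ?(ltnW ik)//; lra.
rewrite big_nat_recr//=; have := nonneg_nth x x0 i; minmax_lra.
Qed.

(* The demand of the earliest classes is what their initial demand leaves once
   the surplus accumulated by the residual process is spent on them. *)
Lemma sum_demand_edf x s k j : nonneg_orthant x -> nonneg_orthant s ->
  (k <= N)%N -> (j <= N)%N ->
  \sum_(0 <= i < j) (demand edf x s k)`_i =
  Num.max 0 (\sum_(k <= i < j) x`_i - Num.max 0 (residual x s k)).
Proof.
move=> x0 s0; elim: k j => [|k IH] j kN jN.
  rewrite /= maxxx subr0 max_r// sumr_ge0// => i _; exact: nonneg_nth.
have {}IH i : (i <= N)%N -> \sum_(0 <= l < i) (demand edf x s k)`_l =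
  Num.max 0 (\sum_(k <= l < i) x`_l - Num.max 0 (residual x s k)).
  by move=> iN; apply: IH => //; exact: ltnW.
have sk := nonneg_nth s s0 k.
set z := demand edf x s k in IH *.
rewrite [residual _ _ k.+1]/=.
have h0 : 0 <= Num.max 0 (residual x s k) by rewrite le_max lexx.
move: (Num.max 0 (residual x s k)) h0 IH => h h0 IH.
have z0 := cumul_nonneg x z k h x0 h0 IH.
(* The grants telescope, and the firm purchase contributes only its term at class [k]. *)
rewrite (eq_big_nat _ _ (F2 := fun i => (z`_i
    - (edf_used z s`_k i.+1 - edf_used z s`_k i))
   - (z`_i - (edf_used z s`_k i.+1 - edf_used z s`_k i)) * (k == i)%:R)); last first.
  by move=> i /andP[_ ij]; rewrite nth_demandS// (leq_trans ij).
rewrite sumrB (sum_delta (fun i => z`_i - (edf_used z s`_k i.+1 - edf_used z s`_k i))).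
rewrite sumrB telescope_sumr// [edf_used _ _ 0]/= subr0.
rewrite !edf_usedE// !IH ?(ltnW kN)// big_nat1 [\sum_(k <= i < k) _]big_geq//.
(* The classes before [k] have no demand left, so they use up none of the supply. *)
rewrite [Num.max 0 (0 - h)]max_l; last by lra.
rewrite (min_r sk) subr0 max0B_min//.
have [kj|jk] := ltnP k j; last first.
  rewrite !big_geq ?(leq_trans jk)//; minmax_lra.
have -> : z`_k = Num.max 0 (x`_k - h).
  have := IH k.+1 kN; rewrite big_nat_recr//= IH ?(ltnW kN)// big_nat1 big_geq//.
  minmax_lra.
rewrite max0B_min// (big_ltn kj).
have : 0 <= \sum_(k.+1 <= i < j) x`_i by rewrite sumr_ge0// => i _; exact: nonneg_nth.
move: (\sum_(k.+1 <= i < j) x`_i) => X X0.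
(* If the new residual is nonnegative, class [k] needs no firm supply and the surplus passes on;
   otherwise firm supply completes class [k] and the later demand [X] stays whole. *)
have [hk|kh] := lerP 0 (h + s`_k - x`_k).
  rewrite (max_l (_ : x`_k - h - s`_k <= 0)); last by lra.
  by rewrite subr0; congr Num.max; lra.
rewrite subr0 !max_r; lra.
Qed.

Lemma firm_used_edf x s (k : 'I_N) : nonneg_orthant x -> nonneg_orthant s ->
  \sum_(j < N) tnth (firm_used edf x s k) j = Num.max 0 (- residual x s k.+1).
Proof.
move=> x0 s0; have sk := nonneg_nth s s0 k; have kN := ltn_ord k.
rewrite (bigD1 k)//= big1 => [|j jk]; last first.
  by rewrite tnth_mktuple (_ : nat_of_ord k == j = false) ?mulr0// eq_sym;
    exact/negbTE.
rewrite addr0 tnth_mktuple eqxx mulr1 edf_muB (tnth_nth 0).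
have cum j := sum_demand_edf x s k j x0 s0 (ltnW kN).
have h0 : 0 <= Num.max 0 (residual x s k) by rewrite le_max lexx.
have z0 := cumul_nonneg x _ k _ x0 h0 cum.
rewrite !edf_usedE// !cum ?(ltnW kN)// big_nat1 big_geq//.
have -> : (demand edf x s k)`_k = Num.max 0 (x`_k - Num.max 0 (residual x s k)).
  have := cum k.+1 kN; rewrite big_nat_recr//= cum ?(ltnW kN)// big_nat1 big_geq//.
  minmax_lra.
move: (Num.max 0 (residual x s k)) h0 => h h0.
rewrite [Num.max 0 (0 - h)]max_l; last by lra.
by rewrite (min_r sk) subr0 max0B_min//; congr Num.max; lra.
Qed.

(** * A subgradient of the cost on each supply path *)

Definition surplus_depleted x (k m : nat) : set (N.-tuple R) :=
  [set v | exists2 t, (k <= t <= m)%N & residual x v t <= 0].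

(** Since [max 0 (- r) = max 0 r - r], each shortfall is an increment of the positive part of the
    residual plus [x]_k - v[_k], and the increments telescope. *)
Lemma sum_shortfall x v m :
  \sum_(0 <= k < m) Num.max 0 (- residual x v k.+1) =
  Num.max 0 (residual x v m) + \sum_(0 <= k < m) (x`_k - v`_k).
Proof.
elim: m => [|m IH]; first by rewrite !big_geq// maxxx addr0.
rewrite !big_nat_recr//= IH; move: (Num.max 0 (residual x v m)) => h.
move: (\sum_(0 <= k < m) _) => S.
minmax_lra.
Qed.

(** The chosen slope of the surplus in [x]_k[is -1 while the residual stays positive
    from]k.+1[to]m[, and 0 once the surplus has been reset, which erases the effect of]x[_k]. *)
Lemma surplus_subgradient x y v m :
  Num.max 0 (residual x v m)
  <= Num.max 0 (residual y v m)
     + \sum_(0 <= k < m) (1 - \1_(surplus_depleted x k.+1 m) v) * (y`_k - x`_k).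
Proof.
elim: m => [|m IH]; first by rewrite big_geq// addr0 lexx.
(* A nonpositive residual at [m.+1] witnesses all the depletion events, so the left side and every
   coefficient vanish. *)
have [xm|xm] := lerP (residual x v m.+1) 0.
  rewrite big_nat_cond big1 ?addr0 ?le_max ?lexx// => k /andP[/andP[_ km] _].
  rewrite indicE mem_set ?subrr ?mul0r//; exists m.+1 => //.
  by rewrite km leqnn.
rewrite big_nat_recr//= indicE memNset; last first.
  move=> [t tm]; have -> : t = m.+1 by apply/eqP; rewrite eqn_leq andbC.
  by move/(lt_le_trans xm); rewrite ltxx.
(* With a positive residual at [m.+1] the new class gets coefficient 1 and the earlier events do not
   change. *)
rewrite subr0 mul1r (eq_big_nat _ _ (F2 := fun k =>
    (1 - \1_(surplus_depleted x k.+1 m) v) * (y`_k - x`_k))); last first.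
  move=> k /andP[_ km]; congr ((1 - _) * _); rewrite !indicE; congr (_%:R).
  congr nat_of_bool; apply/idP/idP => /set_mem[t /andP[kt tm] xt]; apply/mem_set.
    exists t => //; rewrite kt -ltnS ltn_neqAle tm andbT.
    by apply/eqP => tE; move: xt; rewrite tE leNgt xm.
  by exists t => //; rewrite kt ltnW.
move: IH xm; rewrite /=.
move: (Num.max 0 (residual x v m)) (Num.max 0 (residual y v m)) => hx hy.
move: (\sum_(0 <= k < m) _) => S.
minmax_lra.
Qed.

(** The linear part of [sum_shortfall] has slope 1; adding the surplus slope [-(1 - \1)] leaves the
    indicator. *)
Lemma shortfall_subgradient x y v m :
  \sum_(0 <= k < m) Num.max 0 (- residual x v k.+1)
  + \sum_(0 <= k < m) \1_(surplus_depleted x k.+1 m) v * (y`_k - x`_k)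
  <= \sum_(0 <= k < m) Num.max 0 (- residual y v k.+1).
Proof.
rewrite !sum_shortfall; have := surplus_subgradient x y v m.
rewrite (eq_bigr (fun k => (y`_k - v`_k) - (x`_k - v`_k)
   - \1_(surplus_depleted x k.+1 m) v * (y`_k - x`_k))); last by move=> k _; ring.
rewrite !sumrB; lra.
Qed.

End pathwise.

(** * Integration over the supply paths *)

Lemma Rintegral_sum {R : realType} {d} {T : measurableType d}
    (mu : {measure set T -> \bar R}) (D : set T) (I : Type) (r : seq I)
    (f : I -> T -> R) : measurable D ->
  (forall i, mu.-integrable D (EFin \o f i)) ->
  \int[mu]_(x in D) (\sum_(i <- r) f i x) =
  \sum_(i <- r) \int[mu]_(x in D) f i x.
Proof.
move=> mD intf; rewrite /Rintegral.
under eq_integral do rewrite -sumEFin.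
rewrite (integral_sum mD intf) -sum_fine// => i _.
exact: (integrable_fin_num mD (intf i)).
Qed.

Section probability.
Context {R : realType} {N : nat}.
Context {d : measure_display} {T : measurableType d}.
Variables (P : probability T R) (c0 : R) (s : {RV P >-> N.-tuple R}).
Implicit Types (x y p : N.-tuple R).

Lemma measurable_nth_supply k : measurable_fun setT (fun w => (s w)`_k).
Proof.
have [kN|Nk] := ltnP k N.
  rewrite (_ : (fun w => _) = (fun v => tnth v (Ordinal kN)) \o s).
    apply: measurableT_comp; first exact: measurable_tnth.
    exact: measurable_funPT.
  by apply/funext => w /=; rewrite (tnth_nth 0).
rewrite (_ : (fun w => _) = cst 0); first exact: measurable_cst.
by apply/funext => w; rewrite nth_default ?size_tuple.
Qed.

Lemma measurable_residual x k : measurable_fun setT (fun w => residual x (s w) k).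
Proof.
elim: k => [|k IH] /=; first exact: measurable_cst.
apply: measurable_funB; last exact: measurable_cst.
apply: measurable_funD; last exact: measurable_nth_supply.
exact: measurable_maxr.
Qed.

Lemma measurable_residual_le0 x t : measurable [set w | residual x (s w) t <= 0].
Proof.
rewrite -[X in measurable X]setTI; apply: measurable_fun_le => //.
exact: measurable_residual.
Qed.

Lemma measurable_surplus_depleted x k m : measurable (s @^-1` surplus_depleted x k m).
Proof.
rewrite (_ : _ @^-1` _ = \bigcup_(t in [set t | (k <= t <= m)%N])
  [set w | residual x (s w) t <= 0]); last by apply/seteqP; split.
by apply: bigcup_measurable => t _; exact: measurable_residual_le0.
Qed.

Lemma probability_surplus_depleted x k m : (k <= m)%N ->
  fine (P (s @^-1` surplus_depleted x k m)) =
  fine (P [set w | residual x (s w) k <= 0]) +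
  \sum_(k.+1 <= t < m.+1)
    fine (P [set w | (forall i, (k <= i < t)%N -> 0 < residual x (s w) i)
                     /\ residual x (s w) t <= 0]).
Proof.
elim: m => [|m IH] km.
  rewrite big_geq// addr0; congr (fine (P _)); apply/seteqP; split => w /=.
    by move=> [t /andP[_]]; move: km; rewrite !leqn0 => /eqP -> /eqP ->.
  by move=> w0; exists k => //; rewrite leqnn.
have [/eqP km1|] := boolP (k == m.+1).
  rewrite -km1 big_geq// addr0; congr (fine (P _)); apply/seteqP; split => w /=.
    by move=> [t /andP[kt tk]]; have -> : t = k by apply/eqP; rewrite eqn_leq tk.
  by move=> w0; exists k => //; rewrite leqnn.
rewrite -ltnS in km => kNm; have {}km : (k <= m)%N.
  by rewrite -ltnS ltn_neqAle kNm.
rewrite big_nat_recr//= addrA -IH//.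
(* The term for [t = m.+1] is the part of the new event disjoint from depletion up to [m], so
   probabilities add. *)
have first_le0 : [set w | (forall i, (k <= i < m.+1)%N -> 0 < residual x (s w) i)
     /\ residual x (s w) m.+1 <= 0] =
   [set w | residual x (s w) m.+1 <= 0] `\` (s @^-1` surplus_depleted x k m).
  apply/seteqP; split => w /= [].
    move=> pos xm; split=> // -[t ktm]; apply/negP; rewrite -ltNge; exact: pos.
  move=> xm nos; split=> // i kim; rewrite ltNge; apply/negP => xi.
  by apply: nos; exists i.
have -> : s @^-1` surplus_depleted x k m.+1 = s @^-1` surplus_depleted x k m `|`
    ([set w | residual x (s w) m.+1 <= 0] `\` (s @^-1` surplus_depleted x k m)).
  apply/seteqP; split => w /=.
    move=> [t /andP[kt tm1] xt].
    have [nos|nos] := pselect (surplus_depleted x k m (s w)); [by left|right; split=> //].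
    move: tm1 xt; rewrite leq_eqVlt => /predU1P[->//|tm xt].
    by case: nos; exists t => //; rewrite kt.
  move=> [[t /andP[kt tm] xt]|[xm _]]; first by exists t => //; rewrite kt leqW.
  by exists m.+1 => //; rewrite leqnn leqW.
have mA := measurable_surplus_depleted x k m.
have mB := measurable_residual_le0 x m.+1.
rewrite first_le0 measureU//; [|exact: measurableD|exact: setDIK].
by rewrite fineD// fin_num_measure//; exact: measurableD.
Qed.

Lemma tnth_zeta x (j : 'I_N) :
  tnth (zeta P c0 s x) j = c0 * fine (P (s @^-1` surplus_depleted x j.+1 N)).
Proof. by rewrite tnth_mktuple probability_surplus_depleted. Qed.

(** Prices decrease because the depletion event shrinks as its first admissible time grows. *)
Lemma zeta_price_bundle x : 0 <= c0 -> price_bundles (zeta P c0 s x).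
Proof.
move=> c0_ge0; split=> [j|i j ij]; rewrite !tnth_zeta.
  by rewrite mulr_ge0// fine_ge0.
have mA k := measurable_surplus_depleted x k N.
rewrite ler_wpM2l// fine_le ?fin_num_measure//.
apply: le_measure; rewrite ?inE// => w [t /andP[jt tN] xt].
by exists t => //; rewrite tN (leq_trans _ jt).
Qed.

Hypothesis s_ge0 : forall w, nonneg_orthant (s w).

Definition shortfall x k w : R := Num.max 0 (- residual x (s w) k.+1).

Lemma measurable_shortfall x k : measurable_fun setT (shortfall x k).
Proof.
apply: measurable_maxr; first exact: measurable_cst.
by apply: measurableT_comp => //; exact: measurable_residual.
Qed.

Lemma integrable_shortfall x k : nonneg_orthant x ->
  P.-integrable setT (EFin \o shortfall x k).
Proof.
move=> x0; apply: measurable_bounded_integrable => //.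
- by rewrite -ge0_fin_numE ?fin_num_measure.
- exact: measurable_shortfall.
exists x`_k; split=> [|M xM w _ /=]; first exact: num_real.
apply: le_trans (ltW xM); rewrite ger0_norm ?le_max ?lexx//.
have := nonneg_nth _ (s_ge0 w) k; have := nonneg_nth x x0 k.
have : 0 <= Num.max 0 (residual x (s w) k) by rewrite le_max lexx.
rewrite ge_max /= => ? ? ?; apply/andP; split; lra.
Qed.

(** This shows the extended-real cost to be finite, so that profits can be compared in [R]. *)
Lemma expected_cost_edf x : nonneg_orthant x ->
  expected_cost P c0 s x edf =
  (c0 * \int[P]_w (\sum_(0 <= k < N) shortfall x k w))%:E.
Proof.
move=> x0; rewrite Rintegral_sum//; last by move=> k; exact: integrable_shortfall.
rewrite big_mkord mulr_sumr -sumEFin; apply: eq_bigr => k _.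
rewrite -RintegralZl//; last exact: integrable_shortfall.
rewrite expectation.unlock.
rewrite /Rintegral fineK; last first.
  apply: integrable_fin_num => //.
  under eq_fun do rewrite EFinM.
  by apply: integrableZl => //; exact: integrable_shortfall.
by apply: eq_integral => w _; rewrite -mulr_sumr firm_used_edf.
Qed.

Lemma expected_shortfall_subgradient x y : nonneg_orthant x -> nonneg_orthant y ->
  \int[P]_w (\sum_(0 <= k < N) shortfall x k w)
  + \sum_(k < N) fine (P (s @^-1` surplus_depleted x k.+1 N)) * (tnth y k - tnth x k)
  <= \int[P]_w (\sum_(0 <= k < N) shortfall y k w).
Proof.
move=> x0 y0.
have int_indic k : P.-integrable setT
    (EFin \o (fun w => \1_(s @^-1` surplus_depleted x k.+1 N) w * (y`_k - x`_k))).
  rewrite (_ : EFin \o _ = fun w => ((\1_(s @^-1` surplus_depleted x k.+1 N) w)%:E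
     * (y`_k - x`_k)%:E)%E)//.
  apply: integrableZr => //; apply: integrable_indic.
  exact: measurable_surplus_depleted.
have int_sum (f : nat -> T -> R) : (forall k, P.-integrable setT (EFin \o f k)) ->
    P.-integrable setT (EFin \o (fun w => \sum_(0 <= k < N) f k w)).
  move=> intf; rewrite (_ : EFin \o _ = fun w => (\sum_(0 <= k < N) (f k w)%:E)%E).
    apply: integrable_sum => // k _; exact: intf.
  by apply: funext => w; rewrite /= sumEFin.
(* Probabilities are written as integrals of indicators, so that the pathwise inequality can be
   integrated. *)
have -> : \sum_(k < N) fine (P (s @^-1` surplus_depleted x k.+1 N))
      * (tnth y k - tnth x k) =
    \int[P]_w (\sum_(0 <= k < N)
      \1_(s @^-1` surplus_depleted x k.+1 N) w * (y`_k - x`_k)).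
  rewrite Rintegral_sum// big_mkord; apply: eq_bigr => k _.
  have mA := measurable_surplus_depleted x k.+1 N.
  rewrite RintegralZr//; last exact: integrable_indic.
  by rewrite /Rintegral integral_indic// setIT !(tnth_nth 0).
rewrite -RintegralD//; first last.
- exact: int_sum.
- by apply: int_sum => k; exact: integrable_shortfall.
apply: le_Rintegral => //.
- rewrite [X in _.-integrable _ X](_ : _ = fun w =>
    ((\sum_(0 <= k < N) shortfall x k w)%:E + (\sum_(0 <= k < N)
      \1_(s @^-1` surplus_depleted x k.+1 N) w * (y`_k - x`_k))%:E)%E)//.
  apply: integrableD => //; last exact: int_sum.
  by apply: int_sum => k; exact: integrable_shortfall.
- by apply: int_sum => k; exact: integrable_shortfall.
- by move=> w _; exact: (shortfall_subgradient x y (s w) N).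
Qed.

Lemma zeta_profit_maximizing x : 0 <= c0 -> nonneg_orthant x ->
  profit_maximizing P c0 s (zeta P c0 s x) x.
Proof.
move=> c0_ge0 x0 y y0; rewrite /expected_profit !expected_cost_edf//.
rewrite -!EFinB lee_fin -subr_ge0.
have := expected_shortfall_subgradient x y x0 y0.
move: (\int[P]_w _) (\int[P]_w _) => Qx Qy sub.
(* Expanding the revenue of [y] around [x] turns the claim into [c0] times the subgradient
   inequality. *)
have -> : \sum_(j < N) tnth (zeta P c0 s x) j * tnth y j =
    \sum_(j < N) tnth (zeta P c0 s x) j * tnth x j +
    c0 * \sum_(j < N) fine (P (s @^-1` surplus_depleted x j.+1 N))
      * (tnth y j - tnth x j).
  rewrite mulr_sumr -big_split /=; apply: eq_bigr => j _.
  by rewrite tnth_zeta; ring.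
have := ler_wpM2l c0_ge0 sub; rewrite mulrDr; lra.
Qed.

End probability.

Theorem theorem2 (R : realType) (N : nat) (N_ge1 : (1 <= N)%N)
    (c0 : R) (c0_gt0 : 0 < c0)
    (SS : set R) (SS_itv : is_interval SS) (SS_ge0 : forall r, SS r -> 0 <= r)
    (d : measure_display) (T : measurableType d) (P : probability T R)
    (s : {RV P >-> N.-tuple R}) (s_SS : forall w k, SS (tnth (s w) k))
    (s_ac : distribution P s `<< lebesgue_tuple N)
    (s_compact : compact (measure_support (distribution P s))) :
  (forall x : N.-tuple R, nonneg_orthant x -> price_bundles (zeta P c0 s x)) /\
  (forall x p : N.-tuple R, nonneg_orthant x -> price_bundles p ->
     p = zeta P c0 s x -> profit_maximizing P c0 s p x).
Proof.
have s_ge0 w : nonneg_orthant (s w) by move=> j; exact/SS_ge0/s_SS.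
split=> [x _|x p x0 _ ->]; first exact/zeta_price_bundle/ltW.
exact: (zeta_profit_maximizing P c0 s s_ge0 x (ltW c0_gt0) x0).
Qed.
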